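(* Let $n \geq 1$ be an integer with prime factorization $n = p_1^{\alpha_1} p_2^{\alpha_2} \cdots p_\omega^{\alpha_\omega}$, where $p_1,\ldots,p_\omega$ are distinct primes and $\alpha_1,\ldots,\alpha_\omega \geq 1$ are integers (with $\omega = 0$ and empty products equal to $1$ when $n=1$). Then $$\kappa_0(n) = \frac{1}{2} \sum_{i=0}^\infty \frac{1}{2^i} \prod_{k=1}^\omega \binom{\alpha_k + i}{\alpha_k}.$$ Moreover, if $n \geq 2$, then $$\kappa_0(n) = 2K(n) = \frac{1}{2} \sum_{i=0}^\infty \frac{1}{2^i} \prod_{k=1}^\omega \binom{\alpha_k + i}{\alpha_k} = \frac{1}{2}\; {}_\omega F_{\omega-1}\!\left[\begin{matrix}\alpha_1+1, \ldots, \alpha_\omega+1\\ 1, \ldots, 1\end{matrix} ; \frac{1}{2}\right],$$ where the generalized hypergeometric function has $\omega$ upper parameters $\alpha_1+1,\ldots,\alpha_\omega+1$ and $\omega-1$ lower parameters all equal to $1$.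
   Context: The arithmetic functions $K$ (number of ordered factorizations of $n$ into integers greater than one) and $\kappa_0$ (number of recursive divisors of $n$) are defined on positive integers $n$ by the recursions $$K(n) = \varepsilon(n) + \sum_{d \mid n,\ d < n} K(d), \qquad \kappa_0(n) = 1 + \sum_{d \mid n,\ d < n} \kappa_0(d),$$ where $\varepsilon(1) = 1$ and $\varepsilon(n) = 0$ for $n \geq 2$, and the sums run over the proper positive divisors $d$ of $n$ (divisors $d$ with $d<n$, including $d=1$ when $n\ge 2$; the sums are empty when $n=1$). The generalized hypergeometric function is $${}_pF_q\!\left[\begin{matrix}a_1,\ldots,a_p\\ b_1,\ldots,b_q\end{matrix};z\right] = \sum_{i=0}^\infty \frac{(a_1)_i\cdots(a_p)_i}{(b_1)_i\cdots(b_q)_i}\,\frac{z^i}{i!},$$ where $(a)_0 = 1$ and $(a)_i = a(a+1)\cdots(a+i-1)$ for $i \geq 1$. *)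

(* Defs.v *)
From mathcomp Require Import all_boot all_order all_algebra.
From mathcomp Require Import all_classical all_reals all_analysis.
Set Implicit Arguments.
Unset Strict Implicit.
Unset Printing Implicit Defensive.
Import Order.TTheory GRing.Theory Num.Theory.
Import numFieldNormedType.Exports.

Local Open Scope nat_scope.

(* Fuelled form of f(n) = e(n) + \sum_(d %| n, d < n) f(d).  Proper divisors
   strictly decrease, so fuel n suffices at n (divisor_rec_eq below). *)
Fixpoint divisor_rec_fuel (e : nat -> nat) (k n : nat) : nat :=
  if k is k'.+1 then
    e n + \sum_(d <- divisors n | d < n) divisor_rec_fuel e k' d
  else 0.

Definition divisor_rec (e : nat -> nat) (n : nat) : nat :=
  divisor_rec_fuel e n n.

Lemma divisor_rec_fuel_indep (e : nat -> nat) (k n : nat) :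
  0 < n -> n <= k -> divisor_rec_fuel e k n = divisor_rec e n.
Proof.
elim/ltn_ind: n k => n IHn [|k] n_gt0 le_nk; first by case: n n_gt0 le_nk {IHn}.
rewrite /divisor_rec; case: n n_gt0 le_nk IHn => // n _ le_nk IHn /=.
congr (_ + _); rewrite big_seq_cond [RHS]big_seq_cond.
apply: eq_bigr => d /andP[]; rewrite -dvdn_divisors // => dv_d lt_d.
have d_gt0 : 0 < d := dvdn_gt0 (ltn0Sn n) dv_d.
by rewrite !IHn //; apply: leq_trans lt_d le_nk.
Qed.

Lemma divisor_rec_eq (e : nat -> nat) (n : nat) : 0 < n ->
  divisor_rec e n = e n + \sum_(d <- divisors n | d < n) divisor_rec e d.
Proof.
case: n => // n _; rewrite {1}/divisor_rec /=; congr (_ + _).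
rewrite big_seq_cond [RHS]big_seq_cond.
apply: eq_bigr => d /andP[]; rewrite -dvdn_divisors // => dv_d lt_d.
by rewrite divisor_rec_fuel_indep // (dvdn_gt0 (ltn0Sn n) dv_d).
Qed.

Definition epsilon (n : nat) : nat := if n == 1 then 1 else 0.

Definition K (n : nat) : nat := divisor_rec epsilon n.

Definition kappa0 (n : nat) : nat := divisor_rec (fun=> 1) n.

Lemma K_eq (n : nat) : 0 < n ->
  K n = epsilon n + \sum_(d <- divisors n | d < n) K d.
Proof. exact: divisor_rec_eq. Qed.

Lemma kappa0_eq (n : nat) : 0 < n ->
  kappa0 n = 1 + \sum_(d <- divisors n | d < n) kappa0 d.
Proof. exact: divisor_rec_eq. Qed.

Local Open Scope ring_scope.

Definition rising_factorial (R : realType) (a : R) (i : nat) : R :=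
  \prod_(j < i) (a + j%:R).

Definition hypergeometric_term (R : realType) (p q : nat)
    (a : 'I_p -> R) (b : 'I_q -> R) (z : R) (i : nat) : R :=
  (\prod_(k < p) rising_factorial (a k) i)
  / (\prod_(k < q) rising_factorial (b k) i) * (z ^+ i / i`!%:R).

(* limn is total: this is the hypergeometric value only when the series
   converges (and no b k is a nonpositive integer). *)
Definition hypergeometric (R : realType) (p q : nat)
    (a : 'I_p -> R) (b : 'I_q -> R) (z : R) : R :=
  limn (series (hypergeometric_term a b z)).

Definition binomial_term (R : realType) (w : nat) (alpha : 'I_w -> nat)
    (i : nat) : R :=
  1 / 2 ^+ i * \prod_(k < w) 'C(alpha k + i, alpha k)%:R.

(* Main.v *)
Require Import Defs.
From mathcomp Require Import all_boot all_order all_algebra.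
From mathcomp Require Import all_classical all_reals all_analysis.
From mathcomp Require Import ring lra zify.
Set Implicit Arguments.
Unset Strict Implicit.
Unset Printing Implicit Defensive.
Import Order.TTheory GRing.Theory Num.Theory.
Import numFieldNormedType.Exports.
Local Open Scope classical_set_scope.
Local Open Scope ring_scope.

(** Let [d_i(n)] be the number of ways to write [n] as an ordered product of [i]
    positive integers (Piltz's divisor function), and [piltz i = d_(i+1)], so
    that [piltz 0 = 1] and [piltz (i+1) n] is the sum of [piltz i d] over
    [d %| n]. This recursion preserves multiplicativity ([piltzM]) and on prime
    powers it is the hockey-stick identity ([piltz_pfactor]); hence [piltz i n]
    is the product of the binomials [C(alpha_k + i, alpha_k)] ([piltz_prod]),
    and the series of the theorem is the sum [L n] of [piltz i n / 2 ^ i].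

    Splitting off the term [i = 0] turns the divisor recursion for [piltz] into
    [L n = 1 + 1/2 * (sum of L d over d %| n)] ([lim_series_piltz_eq]), where
    [L n] occurs again at [d = n] with weight one half. Solving for it gives
    [L n / 2 = 1 + (sum of L d / 2 over proper divisors d)], which is the
    recursion defining [kappa0], so [L n = 2 * kappa0 n]. Convergence comes from
    the same identity read on partial sums: by induction on their length they
    stay below [2 * kappa0 n] ([series_piltz_le]).

    The relation with [K] is the identity [2 * K = kappa0 + epsilon], proved by
    strong induction ([double_K]). Finally, a rising factorial of [a + 1] is
    [C(a + i, a) * i`!], so the [w] upper parameters contribute [i`! ^ w], which
    the [w - 1] lower parameters equal to one and the factor [1 / i`!] cancel:
    the hypergeometric series agrees with the binomial one term by term
    ([hypergeometric_term_binomial]). *)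

(** * Sums over divisors *)

Lemma sum_divisors_proper (V : nmodType) (f : nat -> V) (n : nat) : (0 < n)%N ->
  \sum_(d <- divisors n) f d = f n + \sum_(d <- divisors n | (d < n)%N) f d.
Proof.
move=> n_gt0; rewrite (bigD1_seq n) ?divisors_uniq ?divisors_id //=.
congr (_ + _); rewrite big_seq_cond [RHS]big_seq_cond; apply: eq_bigl => d.
case d_n: (d \in _) => //=; move: d_n; rewrite -dvdn_divisors // => d_n.
by rewrite ltn_neqAle dvdn_leq // andbT.
Qed.

(** For coprime [m] and [n] the map [x |-> (gcdn x m, gcdn x n)] inverts the
    multiplication of divisors. *)
Lemma perm_divisorsM (m n : nat) : (0 < m)%N -> (0 < n)%N -> coprime m n ->
  perm_eq (divisors (m * n))
          [seq (d * e)%N | d <- divisors m, e <- divisors n].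
Proof.
move=> m_gt0 n_gt0 co_mn; have mn_gt0 : (0 < m * n)%N by rewrite muln_gt0 m_gt0.
apply: uniq_perm; first exact: divisors_uniq.
  apply: allpairs_uniq; try exact: divisors_uniq.
  move=> x y /allpairsP[[d e] /= [dm en ->]] {x}.
  move=> /allpairsP[[d' e'] /= [dm' en' ->]] {y}.
  move: dm en dm' en'; rewrite -!dvdn_divisors // => dm en dm' en' /= eq_de.
  have fst_gcd (x y : nat) : (x %| m -> y %| n -> gcdn m (x * y) = x)%N.
    move=> xm yn; rewrite Gauss_gcdl; first exact/gcdn_idPr.
    exact: coprime_dvdr yn co_mn.
  have snd_gcd (x y : nat) : (x %| m -> y %| n -> gcdn n (x * y) = y)%N.
    move=> xm yn; rewrite Gauss_gcdr; first exact/gcdn_idPr.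
    by rewrite coprime_sym; apply: coprime_dvdl xm co_mn.
  congr pair; first by rewrite -(fst_gcd d e) // eq_de fst_gcd.
  by rewrite -(snd_gcd d e) // eq_de snd_gcd.
move=> x; apply/idP/allpairsP; rewrite -dvdn_divisors //.
  move=> x_mn; exists (gcdn x m, gcdn x n) => /=.
  rewrite -!dvdn_divisors // !dvdn_gcdr; split=> //.
  apply/eqP; rewrite eqn_dvd; apply/andP; split.
    (* The product of the two gcds is the gcd of x * x, m * x, x * n, m * n. *)
    rewrite muln_gcdl !muln_gcdr !dvdn_gcd x_mn.
    by rewrite dvdn_mulr // dvdn_mulr // dvdn_mull //.
  rewrite Gauss_dvd ?dvdn_gcdl //.
  exact: coprime_dvdl (dvdn_gcdr _ _) (coprime_dvdr (dvdn_gcdr _ _) co_mn).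
case=> -[d e] /=; rewrite -!dvdn_divisors // => -[dm en ->].
exact: dvdn_mul.
Qed.

Lemma sum_divisorsM (V : nmodType) (f : nat -> V) (m n : nat) :
    (0 < m)%N -> (0 < n)%N -> coprime m n ->
  \sum_(d <- divisors (m * n)) f d
  = \sum_(d <- divisors m) \sum_(e <- divisors n) f (d * e)%N.
Proof.
move=> m_gt0 n_gt0 co_mn.
by rewrite (perm_big _ (perm_divisorsM m_gt0 n_gt0 co_mn)) big_allpairs_dep.
Qed.

Lemma sum_divisors_pfactor (V : nmodType) (f : nat -> V) (p a : nat) :
  prime p -> \sum_(d <- divisors (p ^ a)) f d = \sum_(j < a.+1) f (p ^ j)%N.
Proof.
move=> p_pr; have pa_gt0 : (0 < p ^ a)%N by rewrite expn_gt0 prime_gt0.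
rewrite -(big_mkord xpredT (fun j => f (p ^ j)%N)).
rewrite -(big_map (fun j => p ^ j)%N xpredT).
apply/perm_big/uniq_perm; first exact: divisors_uniq.
  rewrite map_inj_uniq ?iota_uniq //; apply: expnI; exact: prime_gt1.
move=> x; rewrite -dvdn_divisors //.
apply/(dvdn_pfactor _ _ p_pr)/mapP => -[j].
  by move=> le_ja ->; exists j; rewrite // mem_index_iota.
by rewrite mem_index_iota => le_ja ->; exists j.
Qed.

(** * Piltz divisor functions *)

(** The index is shifted by one from the usual one: [piltz i n] counts the
    ordered factorizations of [n] into [i.+1] positive factors, which is what
    the [i]-th term of the series needs. *)
Fixpoint piltz (i n : nat) : nat :=
  if i is i'.+1 then (\sum_(d <- divisors n) piltz i' d)%N else 1%N.

Lemma piltzM (i m n : nat) : (0 < m)%N -> (0 < n)%N -> coprime m n ->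
  piltz i (m * n) = (piltz i m * piltz i n)%N.
Proof.
elim: i m n => [|i IHi] m n m_gt0 n_gt0 co_mn //=.
rewrite (sum_divisorsM (piltz i)) // big_distrl /=.
rewrite big_seq [RHS]big_seq; apply: eq_bigr => d.
rewrite -dvdn_divisors // => dm; rewrite big_distrr /=.
rewrite big_seq [RHS]big_seq; apply: eq_bigr => e.
rewrite -dvdn_divisors // => en; apply: IHi.
- exact: dvdn_gt0 dm.
- exact: dvdn_gt0 en.
- exact: coprime_dvdl dm (coprime_dvdr en co_mn).
Qed.

(** The divisors of [p ^ a] are the powers [p ^ j] with [j <= a], so the recursion
    sums [C(j + i, j)] over [j <= a]: this is the hockey-stick identity. *)
Lemma piltz_pfactor (i p a : nat) : prime p -> piltz i (p ^ a) = 'C(a + i, a).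
Proof.
move=> p_pr; elim: i a => [|i IHi] a; first by rewrite addn0 binn.
rewrite /= (sum_divisors_pfactor (piltz i)) //.
rewrite (eq_bigr _ (fun j _ => IHi (val j))) /=.
elim: a => [|a IHa]; first by rewrite big_ord1 !bin0.
rewrite big_ord_recr /= IHa -[RHS]/'C((a + i.+1).+1, a.+1) binS addSnnS.
exact: addnC.
Qed.

Lemma piltz_prod (i w : nat) (p alpha : 'I_w -> nat) :
    (forall k, prime (p k)) -> injective p ->
  piltz i (\prod_(k < w) p k ^ alpha k)%N
  = (\prod_(k < w) 'C(alpha k + i, alpha k))%N.
Proof.
elim: w p alpha => [|w IHw] p alpha p_pr p_inj.
  (* The empty product 1 is treated as the prime power 2 ^ 0. *)
  by rewrite !big_ord0 (piltz_pfactor i 0 (isT : prime 2)) bin0.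
rewrite !big_ord_recr /= piltzM.
- rewrite piltz_pfactor // IHw // => k l /p_inj /(congr1 val) /= /val_inj//.
- by apply: prodn_gt0 => k; rewrite expn_gt0 prime_gt0.
- by rewrite expn_gt0 prime_gt0.
elim/big_ind: _ => [|x y co_x co_y|k _]; first exact: coprime1n.
  by rewrite coprimeMl co_x.
apply/coprimeXl/coprimeXr; rewrite prime_coprime // dvdn_prime2 //.
apply/eqP=> /p_inj /(congr1 val) /= eq_kw.
by move: (ltn_ord k); rewrite eq_kw ltnn.
Qed.

(** * The recursive divisor functions *)

(** This is the recursion of [kappa0] with [kappa0 n] added to both sides, so that
    the sum runs over all divisors, as in the recursion of [piltz]. *)
Lemma double_kappa0 (n : nat) : (0 < n)%N ->
  (2 * kappa0 n = 1 + \sum_(d <- divisors n) kappa0 d)%N.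
Proof.
move=> n_gt0; rewrite (sum_divisors_proper kappa0) //.
by rewrite mul2n -addnn {1}kappa0_eq // -addnA; congr (_ + _)%N; apply: addnC.
Qed.

(** The recursions of [2 * K] and of [kappa0 + epsilon] have the same inhomogeneous
    part: it is [2 * epsilon n] for the former, and for the latter
    [1 + epsilon n] minus the sum of [epsilon] over the proper divisors, while
    the sum of [epsilon] over all divisors of [n] is [1]. *)
Lemma double_K (n : nat) : (0 < n)%N -> (2 * K n = kappa0 n + epsilon n)%N.
Proof.
elim/ltn_ind: n => n IHn n_gt0.
have sum_eps : (\sum_(d <- divisors n) epsilon d = 1)%N.
  rewrite (bigD1_seq 1%N) ?divisors_uniq ?divisor1 //=.
  by rewrite big1 // /epsilon => d /negPf->.
have := sum_divisors_proper epsilon n_gt0; rewrite sum_eps => {}sum_eps.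
have {}sum_eps : (epsilon n + \sum_(d <- divisors n | d < n) epsilon d = 1)%N.
  by [].
rewrite K_eq // kappa0_eq // mulnDr big_distrr /=.
have -> : (\sum_(d <- divisors n | d < n) 2 * K d
           = \sum_(d <- divisors n | d < n) (kappa0 d + epsilon d))%N.
  rewrite big_seq_cond [RHS]big_seq_cond; apply: eq_bigr => d /andP[].
  rewrite -dvdn_divisors // => d_n lt_dn; apply: IHn => //.
  exact: dvdn_gt0 d_n.
rewrite big_split /=; lia.
Qed.

(** * The Piltz series at one half *)

Definition piltz_term (R : realType) (n i : nat) : R :=
  1 / 2 ^+ i * (piltz i n)%:R.

Lemma series_piltzS (R : realType) (n N : nat) :
  series (piltz_term R n) N.+1
  = 1 + 1 / 2 * \sum_(d <- divisors n) series (piltz_term R d) N.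
Proof.
rewrite /series /= big_nat_recl // /piltz_term expr0 divr1 mulr1; congr (_ + _).
rewrite exchange_big /= mulr_sumr; apply: eq_bigr => i _.
rewrite natr_sum !mulr_sumr; apply: eq_bigr => d _.
by rewrite exprS; field; rewrite expf_neq0.
Qed.

(** The bound reproduces itself: if the partial sums of length [N] are below
    [2 * kappa0], those of length [N.+1] are below [1] plus the sum of [kappa0]
    over the divisors of [n], which is again [2 * kappa0 n]. *)
Lemma series_piltz_le (R : realType) (n N : nat) : (0 < n)%N ->
  series (piltz_term R n) N <= (2 * kappa0 n)%:R.
Proof.
elim: N n => [|N IHN] n n_gt0; first by rewrite /series /= big_nil ler0n.
rewrite series_piltzS double_kappa0 // natrD natr_sum lerD2l.
apply: (@le_trans _ _ (1 / 2 * \sum_(d <- divisors n) (2 * kappa0 d)%:R)).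
  apply: ler_wpM2l; first lra.
  rewrite big_seq [leRHS]big_seq; apply: ler_sum => d.
  by rewrite -dvdn_divisors // => d_n; apply/IHN/(dvdn_gt0 n_gt0).
rewrite mulr_sumr; apply: ler_sum => d _; rewrite natrM; lra.
Qed.

Lemma is_cvg_series_piltz (R : realType) (n : nat) : (0 < n)%N ->
  cvgn (series (piltz_term R n)).
Proof.
move=> n_gt0; apply: nondecreasing_is_cvgn; last first.
  by exists (2 * kappa0 n)%:R => _ [N _ <-]; apply: series_piltz_le.
apply/nondecreasing_seqP => N; rewrite seriesSr lerDl.
by rewrite mulr_ge0 // divr_ge0 // exprn_ge0.
Qed.

Lemma lim_series_piltz_eq (R : realType) (n : nat) : (0 < n)%N ->
  limn (series (piltz_term R n))
  = 1 + 1 / 2 * \sum_(d <- divisors n) limn (series (piltz_term R d)).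
Proof.
move=> n_gt0; apply: cvg_lim => //; rewrite -cvg_shiftS.
under eq_fun do rewrite series_piltzS.
apply: cvgD; first exact: cvg_cst.
apply: cvgMr; rewrite big_seq; under eq_fun do rewrite big_seq.
apply: cvg_big => [|d]; first exact: add_continuous.
by rewrite -dvdn_divisors // => d_n; apply/is_cvg_series_piltz/(dvdn_gt0 n_gt0).
Qed.

(** The term [d = n] enters both [lim_series_piltz_eq] and [double_kappa0]; once
    it is isolated, the two recursions determine their solutions from the values
    at proper divisors. *)
Lemma lim_series_piltz (R : realType) (n : nat) : (0 < n)%N ->
  limn (series (piltz_term R n)) = (2 * kappa0 n)%:R.
Proof.
elim/ltn_ind: n => n IHn n_gt0.
move: (lim_series_piltz_eq R n_gt0) (double_kappa0 n_gt0).
rewrite sum_divisors_proper // (sum_divisors_proper kappa0) //.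
have -> : \sum_(d <- divisors n | (d < n)%N) limn (series (piltz_term R d))
          = 2 * (\sum_(d <- divisors n | (d < n)%N) kappa0 d)%:R.
  rewrite natr_sum mulr_sumr big_seq_cond [RHS]big_seq_cond.
  apply: eq_bigr => d /andP[]; rewrite -dvdn_divisors // => d_n lt_dn.
  by rewrite IHn ?natrM // (dvdn_gt0 n_gt0).
move=> lim_eq /(congr1 (fun k => k%:R : R)); rewrite natrM !natrD; lra.
Qed.

(** * Comparison with the hypergeometric series *)

(** Both sides equal [(a + i)`! / a`!]. *)
Lemma rising_factorial_succ (R : realType) (a i : nat) :
  rising_factorial (a%:R + 1 : R) i = ('C(a + i, a) * i`!)%:R.
Proof.
rewrite /rising_factorial; elim: i => [|i IHi].
  by rewrite big_ord0 addn0 binn.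
rewrite big_ord_recr /= {}IHi natr1 -natrD -natrM; congr _%:R.
apply/eqP; rewrite -(eqn_pmul2l (fact_gt0 a)); apply/eqP.
have bf k : (a`! * ('C(a + k, a) * k`!) = (a + k)`!)%N.
  by rewrite mulnCA -{2}(addKn a k) bin_fact // leq_addr.
by rewrite mulnA bf bf addnS addSn factS mulnC.
Qed.

(** The hypothesis [0 < w] makes [w.-1 + 1] equal to [w], as required for the powers
    of [i`!] to cancel. *)
Lemma hypergeometric_term_binomial (R : realType) (w : nat)
    (alpha : 'I_w -> nat) : (0 < w)%N ->
  @hypergeometric_term R w w.-1 (fun k => (alpha k)%:R + 1) (fun=> 1) (1 / 2)
  = binomial_term R alpha.
Proof.
move=> w_gt0; apply/funext => i; rewrite /hypergeometric_term /binomial_term.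
under eq_bigr do rewrite rising_factorial_succ natrM.
rewrite big_split /= !prodr_const !card_ord.
have -> : rising_factorial (1 : R) i = i`!%:R.
  by have := rising_factorial_succ R 0 i; rewrite bin0 mul1n add0r.
have i_neq0 : i`!%:R != 0 :> R by rewrite pnatr_eq0 -lt0n fact_gt0.
case: w w_gt0 alpha => // w _ alpha; rewrite /= exprS expr_div_n expr1n.
by field; rewrite i_neq0 !expf_neq0.
Qed.

Theorem theorem1 (R : realType) (n : nat) (n_ge1 : (1 <= n)%N)
    (w : nat) (p alpha : 'I_w -> nat)
    (p_prime : forall k, prime (p k)) (p_inj : injective p)
    (alpha_ge1 : forall k, (1 <= alpha k)%N)
    (n_fact : n = (\prod_(k < w) p k ^ alpha k)%N) :
  (cvgn (series (binomial_term R alpha))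
   /\ (kappa0 n)%:R = 1 / 2 * limn (series (binomial_term R alpha)))
  /\ ((2 <= n)%N ->
      cvgn (series (@hypergeometric_term R w w.-1
                      (fun k => (alpha k)%:R + 1) (fun=> 1) (1 / 2)))
      /\ kappa0 n = (2 * K n)%N
      /\ (2 * K n)%:R = 1 / 2 * limn (series (binomial_term R alpha))
      /\ 1 / 2 * limn (series (binomial_term R alpha))
         = 1 / 2 * @hypergeometric R w w.-1
                     (fun k => (alpha k)%:R + 1) (fun=> 1) (1 / 2)).
Proof.
have termE : binomial_term R alpha = piltz_term R n.
  apply/funext => i; rewrite /binomial_term /piltz_term n_fact piltz_prod //.
  by rewrite natr_prod.
have cvg_bin : cvgn (series (binomial_term R alpha)).
  by rewrite termE; apply: is_cvg_series_piltz.
have kappaE : (kappa0 n)%:R = 1 / 2 * limn (series (binomial_term R alpha)).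
  by rewrite termE lim_series_piltz // natrM; field.
split=> // n_ge2.
have kappa_K : kappa0 n = (2 * K n)%N.
  by rewrite double_K // /epsilon gtn_eqF // addn0.
have w_gt0 : (0 < w)%N.
  by case: w p alpha n_fact {p_prime p_inj alpha_ge1 termE cvg_bin kappaE}
    => // p alpha n_fact; move: n_ge2; rewrite n_fact big_ord0.
by rewrite /hypergeometric hypergeometric_term_binomial // -kappa_K.
Qed.
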